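(* Consider a scalar conservation law $u_t+f(u)_x=0$ on $\Omega=(x_L,x_R)$, discretized on the cut cell model mesh $\mathcal{M}_h$ with cut cell fraction $\alpha\in(0,\tfrac12]$ by the DoD stabilized discontinuous Galerkin scheme with piecewise constant polynomials ($P^0$) in space and explicit Euler in time (mesh, scheme and stabilization parameter $\eta_{k_1}=\max(1-\frac{\alpha}{\nu},0)$ as defined in the context). Let the time step be given by $\Delta t=\frac{\nu h}{\lambda_{\max}}$, where $0<\alpha<\nu<1-\alpha$. Let the numerical flux $\mathcal{H}:\mathbb{R}\times\mathbb{R}\to\mathbb{R}$ satisfy: (1) (consistency) $\mathcal{H}(u,u)=f(u)$ for all $u$; (2) (continuity) $\mathcal{H}(u^-,u^+)$ is at least Lipschitz continuous with respect to both arguments; (3) (monotonicity) $\mathcal{H}(u^-,u^+)$ is a non-decreasing function of its first argument $u^-$ and a non-increasing function of its second argument $u^+$. Further, with $\mathcal{H}_a$ and $\mathcal{H}_b$ denoting the derivatives of $\mathcal{H}$ with respect to its first and second argument, require $$|\mathcal{H}_a(u,v)|+|\mathcal{H}_b(w,u)|\le\frac{\nu h}{\Delta t}\qquad\text{for all }u,v,w.$$ Then the stabilized scheme is monotone, i.e. for every cell $I_j$ the new value $u_j^{n+1}$, regarded as a function of the old values $u_i^n$, has non-negative partial derivative with respect to each of the old values.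
   Context: **Mesh.** $\Omega=(x_L,x_R)$ is divided into $N$ cells $I_j=(x_{j-\frac12},x_{j+\frac12})$, $j=1,\dots,N$, of equal length $h=(x_R-x_L)/N$. One cell $I_k$ in the interior of the domain ($1<k<N$) is split at a point $x_{\text{cut}}=x_{k-\frac12}+\alpha h$ into two cut cells $I_{k_1}=(x_{k-\frac12},x_{\text{cut}})$ of length $\alpha h$ and $I_{k_2}=(x_{\text{cut}},x_{k+\frac12})$ of length $(1-\alpha)h$, with $\alpha\in(0,\frac12]$. The resulting mesh of $N+1$ cells (with indices $\{1\le j\le N: j\neq k\}\cup\{k_1,k_2\}$) is called $\mathcal{M}_h$. **Scheme.** $u_j^n$ denotes the constant value of the discrete solution on cell $I_j$ at time $t^n$. $\nu>0$ is the CFL parameter, $\lambda_{\max}>0$ is the maximum wave speed (maximum of $|f'|$), and $\eta_{k_1}=\max(1-\frac{\alpha}{\nu},0)$. For piecewise constants the semi-discrete stabilized scheme is $(d_tu^h,w^h)_{L^2}+a_h(u^h,w^h)+J_h(u^h,w^h)=0$ for all piecewise constant $w^h$, where $$a_h(u^h,w^h)=\sum_{j=0}^N\mathcal{H}(u_j,u_{j+1})[[w^h]]_{j+\frac12}+\mathcal{H}(u_{k_1},u_{k_2})[[w^h]]_{\text{cut}}$$ (with the cell to the right of $x_{k-\frac12}$ being $I_{k_1}$ and the cell to the left of $x_{k+\frac12}$ being $I_{k_2}$), and $$J_h(u^h,w^h)=\eta_{k_1}\big[\mathcal{H}(u_{k-1},u_{k_2})-\mathcal{H}(u_{k-1},u_{k_1})\big][[w^h]]_{k-\frac12}+\eta_{k_1}\big[\mathcal{H}(u_{k-1},u_{k_2})-\mathcal{H}(u_{k_1},u_{k_2})\big][[w^h]]_{\text{cut}}.$$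 Here $[[w^h]]$ at an edge is the left value minus the right value (with value $0$ outside $\Omega$). With explicit Euler in time this is the following update: $$u_{k-1}^{n+1}=u_{k-1}^n-\tfrac{\Delta t}{h}\{(1-\eta_{k_1})\mathcal{H}(u_{k-1}^n,u_{k_1}^n)+\eta_{k_1}\mathcal{H}(u_{k-1}^n,u_{k_2}^n)-\mathcal{H}(u_{k-2}^n,u_{k-1}^n)\},$$ $$u_{k_1}^{n+1}=u_{k_1}^n-\tfrac{\Delta t}{\alpha h}(1-\eta_{k_1})\{\mathcal{H}(u_{k_1}^n,u_{k_2}^n)-\mathcal{H}(u_{k-1}^n,u_{k_1}^n)\},$$ $$u_{k_2}^{n+1}=u_{k_2}^n-\tfrac{\Delta t}{(1-\alpha)h}\{\mathcal{H}(u_{k_2}^n,u_{k+1}^n)-(1-\eta_{k_1})\mathcal{H}(u_{k_1}^n,u_{k_2}^n)-\eta_{k_1}\mathcal{H}(u_{k-1}^n,u_{k_2}^n)\},$$ $$u_{k+1}^{n+1}=u_{k+1}^n-\tfrac{\Delta t}{h}\{\mathcal{H}(u_{k+1}^n,u_{k+2}^n)-\mathcal{H}(u_{k_2}^n,u_{k+1}^n)\},$$ and for all other cells $u_j^{n+1}=u_j^n-\tfrac{\Delta t}{h}\{\mathcal{H}(u_j^n,u_{j+1}^n)-\mathcal{H}(u_{j-1}^n,u_j^n)\}$. The exterior values $u_0^n$, $u_{N+1}^n$ used at the boundary encode the boundary conditions and are treated as further old-value arguments. **Monotone method.** A method $u_j^{n+1}=H(u_{j-i_L}^n,u_{j-i_L+1}^n,\dots,u_{j+i_R}^n)$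 is called monotone if for all $j$ and every $l$ with $-i_L\le l\le i_R$ there holds $\frac{\partial H}{\partial u_{j+l}}(u_{j-i_L},\dots,u_{j+i_R})\ge0$. **Convention.** The partial derivatives $\mathcal{H}_a,\mathcal{H}_b$ are assumed to exist at the arguments at which they are written. *)

(* Defs.v *)
From Stdlib Require Import Reals Lra Lia Arith.
From Coquelicot Require Import Coquelicot.
Open Scope R_scope.

(* [Cell j] is the uncut cell I_j; [Cut1] and [Cut2] are the cut cells I_{k_1}
   and I_{k_2}.  [Cell 0] and [Cell (N+1)] carry the exterior (boundary) values.
   A state is a total function on [cell]; its values outside [old_index] are
   never used. *)
Inductive cell : Set := Cell (j : nat) | Cut1 | Cut2.

Definition cell_eq_dec (c d : cell) : {c = d} + {c <> d}.
Proof. decide equality; apply Nat.eq_dec. Defined.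

Definition mesh_cell (N k : nat) (c : cell) : Prop :=
  match c with
  | Cell j => (1 <= j <= N)%nat /\ j <> k
  | Cut1 | Cut2 => True
  end.

Definition old_index (N k : nat) (c : cell) : Prop :=
  match c with
  | Cell j => (j <= N + 1)%nat /\ j <> k
  | Cut1 | Cut2 => True
  end.

Definition state : Type := cell -> R.

Definition set_value (u : state) (c : cell) (s : R) : state :=
  fun d => if cell_eq_dec d c then s else u d.

Definition cell_length (alpha h : R) (c : cell) : R :=
  match c with
  | Cell _ => h
  | Cut1 => alpha * h
  | Cut2 => (1 - alpha) * h
  end.

Definition sum_cells (N k : nat) (g : cell -> R) : R :=
  sum_n_m (fun j => if Nat.eqb j k then g Cut1 + g Cut2 else g (Cell j)) 1 N.

(* The neighbours of the edge x_{j+1/2}; the edge between the two cut cells is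
   treated separately. *)
Definition left_cell (k j : nat) : cell :=
  if Nat.eqb j k then Cut2 else Cell j.
Definition right_cell (k j : nat) : cell :=
  if Nat.eqb (j + 1) k then Cut1 else Cell (j + 1).

(* A test function is extended by zero outside of the domain. *)
Definition extend0 (N : nat) (w : state) : state :=
  fun c => match c with
           | Cell j => if andb (Nat.leb 1 j) (Nat.leb j N) then w c else 0
           | _ => w c
           end.

Definition jump (N k : nat) (w : state) (j : nat) : R :=
  extend0 N w (left_cell k j) - extend0 N w (right_cell k j).

Definition jump_cut (w : state) : R := w Cut1 - w Cut2.

Definition a_form (H : R -> R -> R) (N k : nat) (u w : state) : R :=
  sum_n_m (fun j => H (u (left_cell k j)) (u (right_cell k j)) * jump N k w j) 0 N
  + H (u Cut1) (u Cut2) * jump_cut w.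

Definition J_form (H : R -> R -> R) (N k : nat) (eta : R) (u w : state) : R :=
  let um := u (Cell (k - 1)) in
  eta * (H um (u Cut2) - H um (u Cut1)) * jump N k w (k - 1)
  + eta * (H um (u Cut2) - H (u Cut1) (u Cut2)) * jump_cut w.

(* The semi-discrete scheme tested with every piecewise constant w, the time
   derivative being replaced by the explicit Euler difference quotient. *)
Definition dod_euler_weak (H : R -> R -> R) (N k : nat) (alpha h dt eta : R)
    (u unew : state) : Prop :=
  forall w : state,
    sum_cells N k (fun c => cell_length alpha h c * ((unew c - u c) / dt) * w c)
    + a_form H N k u w + J_form H N k eta u w = 0.

Definition dod_eta (alpha nu : R) : R := Rmax (1 - alpha / nu) 0.

Definition dod_update (H : R -> R -> R) (k : nat) (alpha h dt eta : R)
    (u : state) (c : cell) : R :=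
  match c with
  | Cut1 =>
      u Cut1 - dt / (alpha * h) * (1 - eta)
        * (H (u Cut1) (u Cut2) - H (u (Cell (k - 1))) (u Cut1))
  | Cut2 =>
      u Cut2 - dt / ((1 - alpha) * h)
        * (H (u Cut2) (u (Cell (k + 1)))
           - (1 - eta) * H (u Cut1) (u Cut2)
           - eta * H (u (Cell (k - 1))) (u Cut2))
  | Cell j =>
      if Nat.eqb j (k - 1) then
        u (Cell j) - dt / h
          * ((1 - eta) * H (u (Cell j)) (u Cut1) + eta * H (u (Cell j)) (u Cut2)
             - H (u (Cell (j - 1))) (u (Cell j)))
      else if Nat.eqb j (k + 1) then
        u (Cell j) - dt / h
          * (H (u (Cell j)) (u (Cell (j + 1))) - H (u Cut2) (u (Cell j)))
      else
        u (Cell j) - dt / h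
          * (H (u (Cell j)) (u (Cell (j + 1))) - H (u (Cell (j - 1))) (u (Cell j)))
  end.

Local Ltac real_eq := match goal with |- ?x = ?y => change (@eq R x y) end.

Lemma sum_delta (N m : nat) (x : R) : (1 <= m <= N)%nat ->
  sum_n_m (fun j => if Nat.eqb j m then x else 0) 1 N = x.
Proof.
induction N as [|N IH]; intros Hm; [lia|].
rewrite sum_n_Sm by lia.
destruct (Nat.eq_dec m (S N)) as [->|Hne].
- rewrite Nat.eqb_refl.
  rewrite (sum_n_m_ext_loc _ (fun _ => 0)).
  + change 0 with (@zero R_AbelianMonoid). rewrite sum_n_m_const_zero.
    exact (Rplus_0_l x).
  + intros j Hj. destruct (Nat.eqb_spec j (S N)); [lia|reflexivity].
- rewrite IH by lia.
  destruct (Nat.eqb_spec (S N) m); [lia|]. exact (Rplus_0_r x).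
Qed.

Lemma sum_by_parts (N : nat) (F a b : nat -> R) :
  sum_n_m (fun j => F j * (a j - b j)) 0 N
  = sum_n_m (fun j => F j * a j - F (j - 1)%nat * b (j - 1)%nat) 1 N
    + F O * a O - F N * b N.
Proof.
induction N as [|N IH].
- rewrite sum_n_n, sum_n_m_zero by lia. change (@zero R_AbelianMonoid) with 0.
  real_eq. ring.
- rewrite !sum_n_Sm by lia. rewrite IH.
  unfold plus; simpl. rewrite Nat.sub_0_r.
  real_eq. ring.
Qed.

Lemma forms_sum_cells H N k alpha h dt eta u w :
  (1 < k < N)%nat -> alpha <> 0 -> 1 - alpha <> 0 -> h <> 0 -> dt <> 0 ->
  a_form H N k u w + J_form H N k eta u w
  = sum_cells N k (fun c => cell_length alpha h c
      * ((u c - dod_update H k alpha h dt eta u c) / dt) * w c).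
Proof.
intros Hk Ha Ha' Hh Hdt.
unfold a_form, J_form, jump.
rewrite (sum_by_parts N (fun j => H (u (left_cell k j)) (u (right_cell k j)))).
replace (extend0 N w (left_cell k 0)) with 0.
2:{ unfold left_cell. destruct (Nat.eqb_spec 0 k); [lia|reflexivity]. }
replace (extend0 N w (right_cell k N)) with 0.
2:{ unfold right_cell. destruct (Nat.eqb_spec (N + 1) k); [lia|]. simpl.
    destruct (Nat.leb_spec (N + 1) N); [lia|].
    rewrite Bool.andb_false_r. reflexivity. }
assert (HL : extend0 N w (left_cell k (k - 1)) = w (Cell (k - 1))).
{ unfold left_cell. destruct (Nat.eqb_spec (k - 1) k); [lia|]. unfold extend0.
  destruct (Nat.leb_spec 1 (k - 1)), (Nat.leb_spec (k - 1) N); simpl; lia || reflexivity. }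
assert (HR : extend0 N w (right_cell k (k - 1)) = w Cut1).
{ unfold right_cell. destruct (Nat.eqb_spec (k - 1 + 1) k); [reflexivity|lia]. }
rewrite HL, HR.
set (um := u (Cell (k - 1))).
set (A := eta * (H um (u Cut2) - H um (u Cut1)) * w (Cell (k - 1))).
set (B := - eta * (H um (u Cut2) - H um (u Cut1)) * w Cut1
  + (H (u Cut1) (u Cut2) + eta * (H um (u Cut2) - H (u Cut1) (u Cut2))) * jump_cut w).
match goal with |- ?S + _ - _ + _ + _ = _ =>
  transitivity (S + (sum_n_m (fun j => if Nat.eqb j (k - 1) then A else 0) 1 N
     + sum_n_m (fun j => if Nat.eqb j k then B else 0) 1 N)) end.
{ rewrite !sum_delta by lia. unfold A, B. cbv zeta. ring. }
change Rplus with (@plus R_AbelianMonoid).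
rewrite <- !sum_n_m_plus. unfold sum_cells.
apply sum_n_m_ext_loc. intros j Hj.
change (@plus R_AbelianMonoid) with Rplus. real_eq.
assert (HLj : extend0 N w (left_cell k j) = w (left_cell k j)).
{ unfold left_cell. destruct (Nat.eqb_spec j k); [reflexivity|]. unfold extend0.
  destruct (Nat.leb_spec 1 j), (Nat.leb_spec j N); simpl; lia || reflexivity. }
assert (HRj : extend0 N w (right_cell k (j - 1)) = w (right_cell k (j - 1))).
{ unfold right_cell. destruct (Nat.eqb_spec (j - 1 + 1) k); [reflexivity|]. unfold extend0.
  destruct (Nat.leb_spec 1 (j - 1 + 1)), (Nat.leb_spec (j - 1 + 1) N);
    simpl; lia || reflexivity. }
rewrite HLj, HRj. unfold left_cell, right_cell.
replace (j - 1 + 1)%nat with j by lia.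
destruct (Nat.eqb_spec j k) as [->|Hjk].
{ destruct (Nat.eqb_spec (k + 1) k); [lia|].
  destruct (Nat.eqb_spec (k - 1) k); [lia|].
  destruct (Nat.eqb_spec k (k - 1)); [lia|].
  unfold B, um, jump_cut. simpl. field. auto. }
destruct (Nat.eqb_spec j (k - 1)) as [->|Hjk1].
{ destruct (Nat.eqb_spec (k - 1 + 1) k); [|lia].
  destruct (Nat.eqb_spec (k - 1 - 1) k); [lia|].
  unfold A, um. simpl. rewrite Nat.eqb_refl. field. auto. }
destruct (Nat.eqb_spec (j + 1) k); [lia|].
simpl. destruct (Nat.eqb_spec j (k - 1)); [lia|].
destruct (Nat.eqb_spec (j - 1) k), (Nat.eqb_spec j (k + 1)); try lia; field; auto.
Qed.

Lemma sum_cells_plus N k g1 g2 :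
  sum_cells N k (fun c => g1 c + g2 c) = sum_cells N k g1 + sum_cells N k g2.
Proof.
unfold sum_cells. change Rplus with (@plus R_AbelianMonoid).
rewrite <- sum_n_m_plus. apply sum_n_m_ext. intros j.
change (@plus R_AbelianMonoid) with Rplus.
real_eq. destruct (Nat.eqb j k); ring.
Qed.

Lemma sum_cells_ext N k g1 g2 :
  (forall c, mesh_cell N k c -> g1 c = g2 c) -> sum_cells N k g1 = sum_cells N k g2.
Proof.
intros E. apply sum_n_m_ext_loc. intros j Hj.
destruct (Nat.eqb_spec j k).
- rewrite !E; simpl; auto.
- apply E. simpl. auto.
Qed.

Lemma sum_cells_delta N k c x : (1 < k < N)%nat -> mesh_cell N k c ->
  sum_cells N k (fun d => if cell_eq_dec d c then x else 0) = x.
Proof.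
intros Hk Hc.
set (m := match c with Cell j => j | _ => k end).
transitivity (sum_n_m (fun j => if Nat.eqb j m then x else 0) 1 N).
2:{ apply sum_delta. destruct c; unfold m; simpl in Hc; lia. }
apply sum_n_m_ext. intros j.
destruct (Nat.eqb_spec j k) as [->|Hjk], c as [i| |]; unfold m; simpl in Hc;
  repeat (match goal with
    | |- context [cell_eq_dec ?a ?b] =>
        let E := fresh in
        destruct (cell_eq_dec a b) as [E|E]; try discriminate E; try congruence
    | |- context [Nat.eqb ?a ?b] => destruct (Nat.eqb_spec a b)
    end); try congruence; try lia; real_eq; try ring.
Qed.

Theorem dod_euler_weak_iff H N k alpha h dt eta u unew :
  (1 < k < N)%nat -> alpha <> 0 -> 1 - alpha <> 0 -> h <> 0 -> dt <> 0 ->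
  dod_euler_weak H N k alpha h dt eta u unew
  <-> forall c, mesh_cell N k c -> unew c = dod_update H k alpha h dt eta u c.
Proof.
intros Hk Ha Ha' Hh Hdt.
assert (HE : forall w, sum_cells N k
     (fun c => cell_length alpha h c * ((unew c - u c) / dt) * w c)
     + a_form H N k u w + J_form H N k eta u w
   = sum_cells N k (fun c => cell_length alpha h c
      * ((unew c - dod_update H k alpha h dt eta u c) / dt) * w c)).
{ intros w. rewrite Rplus_assoc.
  rewrite (forms_sum_cells H N k alpha h dt) by assumption.
  rewrite <- sum_cells_plus. apply sum_cells_ext. intros c _. field. auto. }
split.
- intros Hw c Hc.
  specialize (Hw (fun d => if cell_eq_dec d c then 1 else 0)). rewrite HE in Hw.
  rewrite (sum_cells_ext _ _ _ (fun d => if cell_eq_dec d c then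
    cell_length alpha h c * ((unew c - dod_update H k alpha h dt eta u c) / dt)
    else 0)) in Hw.
  + rewrite sum_cells_delta in Hw by assumption.
    assert (Hl : cell_length alpha h c <> 0).
    { destruct c; simpl; auto; apply Rmult_integral_contrapositive; auto. }
    apply Rmult_integral in Hw. destruct Hw as [Hw|Hw]; [contradiction|].
    apply Rmult_integral in Hw. destruct Hw as [Hw|Hw]; [lra|].
    apply Rinv_neq_0_compat in Hdt. contradiction.
  + intros d _. destruct (cell_eq_dec d c) as [->|]; ring.
- intros E w. rewrite HE.
  rewrite (sum_cells_ext _ _ _ (fun c => if cell_eq_dec c Cut1 then 0 else 0)).
  + apply sum_cells_delta; simpl; auto.
  + intros c Hc. rewrite E by assumption.
    destruct (cell_eq_dec c Cut1); field; auto.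
Qed.

(* [i] also ranges over the two exterior values. *)
Definition monotone_scheme (N k : nat) (step : state -> state) : Prop :=
  forall (c i : cell) (u : state), mesh_cell N k c -> old_index N k i ->
    exists d, is_derive (fun s => step (set_value u i s) c) (u i) d /\ 0 <= d.

Definition is_max_wave_speed (f : R -> R) (lambda : R) : Prop :=
  (forall u, ex_derive f u)
  /\ (forall u, Rabs (Derive f u) <= lambda)
  /\ (exists u, Rabs (Derive f u) = lambda).

(* Main.v *)
Require Import Defs.
From Stdlib Require Import Reals.
From Coquelicot Require Import Coquelicot.
From Stdlib Require Import Lra Lia.
Open Scope R_scope.

(** The new value of every cell [c], cut or not, has the form
    [u c - r * (outflow - inflow)], where the outflow is a convex combination of
    fluxes [H (u c) _], the inflow is a convex combination of fluxes
    [H _ (u c)], and no neighbour occurring in them is [c] itself; this is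
    [flux_balance].  The stabilization only moves weight between two neighbours,
    which is why one argument ([flux_balance_monotone]) covers all rows:

    - Differentiating in a neighbour only sees second arguments of outgoing
      fluxes and first arguments of ingoing ones, and monotonicity of [H] gives
      both contributions the right sign.
    - Differentiating in [u c] gives [1 - r * S], where [S] is an average of
      [H_a (u c) _] minus an average of [H_b _ (u c)].  The hypothesis bounds
      [H_a (u c) v - H_b w (u c)] by [K = nu * h / dt] for all independent [v]
      and [w], hence [S <= K], and the derivative is nonnegative when
      [r * K <= 1].

    It remains to compute [r * K] for each cell.  For uncut cells it is [nu < 1].
    For [Cut2] it is [nu / (1 - alpha)], below [1] by assumption.  For [Cut1] it
    is [(nu / alpha) * (1 - eta)], which would exceed [1] without stabilization;
    since [1 - eta = alpha / nu], it equals [1] exactly. *)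

(** * Signs of derivatives *)

Lemma Derive_nonneg_of_nondecreasing (g : R -> R) (x : R) :
  (forall y, ex_derive g y) -> (forall y z, y <= z -> g y <= g z) ->
  0 <= Derive g x.
Proof.
intros hd hm.
assert (pr : derivable g) by (intros y; apply ex_derive_Reals_0, hd).
rewrite <- (Derive_Reals g x (pr x)).
now apply nonneg_derivative_0.
Qed.

Lemma Derive_nonpos_of_nonincreasing (g : R -> R) (x : R) :
  (forall y, ex_derive g y) -> (forall y z, y <= z -> g z <= g y) ->
  Derive g x <= 0.
Proof.
intros hd hm.
enough (0 <= Derive (fun s => - g s) x) by (rewrite Derive_opp in *; lra).
apply Derive_nonneg_of_nondecreasing.
- intros y. exact (ex_derive_opp g y (hd y)).
- intros y z hyz. specialize (hm y z hyz). lra.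
Qed.

(** * Changing one value of a state *)

Lemma set_value_same (u : state) (i : cell) (s : R) : set_value u i s i = s.
Proof. unfold set_value. now destruct (cell_eq_dec i i). Qed.

Lemma set_value_other (u : state) (i d : cell) (s : R) :
  d <> i -> set_value u i s d = u d.
Proof. intros hd. unfold set_value. now destruct (cell_eq_dec d i). Qed.

(** A sign condition [P] that includes [0] holds whether or not [d] is the
    perturbed cell, so each neighbour of a cell is treated on its own, without
    asking which neighbours are perturbed; two of them may be the same cell. *)
Lemma is_derive_set_value (P : R -> Prop) (g : R -> R) (u : state) (i d : cell) :
  (forall x, ex_derive g x) -> (forall x, P (Derive g x)) -> P 0 ->
  exists l, is_derive (fun s => g (set_value u i s d)) (u i) l /\ P l.
Proof.
intros hd hP h0.
destruct (cell_eq_dec d i) as [->|hdi].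
- exists (Derive g (u i)). split; [|apply hP].
  apply (is_derive_ext g).
  + intros s. now rewrite set_value_same.
  + apply Derive_correct, hd.
- exists 0. split; [|exact h0].
  apply (is_derive_ext (fun _ => g (u d))).
  + intros s. now rewrite set_value_other.
  + apply (@is_derive_const R_AbsRing R_NormedModule).
Qed.

(** * Updates with averaged fluxes *)

(** The redistribution of fluxes around the small cell leaves no row with more
    than two neighbours on a side; an ordinary row has [l = m] and [p = q]. *)
Definition flux_balance (H : R -> R -> R) (r mu theta : R) (l m c p q : cell)
    (u : state) : R :=
  u c - r * (((1 - theta) * H (u c) (u p) + theta * H (u c) (u q))
             - ((1 - mu) * H (u l) (u c) + mu * H (u m) (u c))).

Lemma is_derive_weighted_balance (V P Q L M : R -> R) (r mu theta x v p q l m : R) :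
  is_derive V x v -> is_derive P x p -> is_derive Q x q ->
  is_derive L x l -> is_derive M x m ->
  is_derive (fun s => V s - r * (((1 - theta) * P s + theta * Q s)
                                 - ((1 - mu) * L s + mu * M s))) x
    (v - r * (((1 - theta) * p + theta * q) - ((1 - mu) * l + mu * m))).
Proof.
intros hV hP hQ hL hM.
auto_derive.
- repeat split; eexists; eassumption.
- rewrite (is_derive_unique (fun s : R => V s) _ _ hV),
    (is_derive_unique (fun s : R => P s) _ _ hP),
    (is_derive_unique (fun s : R => Q s) _ _ hQ),
    (is_derive_unique (fun s : R => L s) _ _ hL),
    (is_derive_unique (fun s : R => M s) _ _ hM).
  ring.
Qed.

(** The CFL condition is [r * K <= 1].  In the bound on the derivatives the two
    outer arguments are independent; this is what allows the averages over
    different neighbours on the two sides to be estimated termwise. *)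
Lemma flux_balance_monotone (H : R -> R -> R) (K r mu theta : R)
    (l m c p q i : cell) (u : state) :
  (forall x x' y, x <= x' -> H x y <= H x' y) ->
  (forall x y y', y <= y' -> H x y' <= H x y) ->
  (forall x y, ex_derive (fun s => H s y) x) ->
  (forall x y, ex_derive (fun s => H x s) y) ->
  (forall x y z,
     Rabs (Derive (fun s => H s y) x) + Rabs (Derive (fun s => H z s) x) <= K) ->
  0 <= r -> r * K <= 1 -> 0 <= mu <= 1 -> 0 <= theta <= 1 ->
  l <> c -> m <> c -> p <> c -> q <> c ->
  exists d,
    is_derive (fun s => flux_balance H r mu theta l m c p q (set_value u i s))
      (u i) d /\ 0 <= d.
Proof.
intros hincr hdecr hHa hHb hK hr hrK hmu htheta hl hm hp hq.
assert (ha : forall x y, 0 <= Derive (fun s => H s y) x).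
{ intros x y. apply (Derive_nonneg_of_nondecreasing (fun s => H s y)); auto. }
assert (hb : forall x y, Derive (fun s => H x s) y <= 0).
{ intros x y. apply (Derive_nonpos_of_nonincreasing (fun s => H x s)); auto. }
destruct (cell_eq_dec i c) as [->|hic].
- assert (hab : forall y z,
    Derive (fun s => H s y) (u c) - Derive (fun s => H z s) (u c) <= K).
  { intros y z. specialize (hK (u c) y z). specialize (hb z (u c)).
    rewrite Rabs_pos_eq, Rabs_left1 in hK by auto. lra. }
  eexists. split.
  + eapply is_derive_ext; cycle 1.
    * apply (is_derive_weighted_balance (fun s => s) (fun s => H s (u p))
        (fun s => H s (u q)) (fun s => H (u l) s) (fun s => H (u m) s)
        r mu theta);
        [exact (is_derive_id (K := R_AbsRing) (u c)) | apply Derive_correct; auto ..].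
    * intros s. unfold flux_balance.
      now rewrite set_value_same, !set_value_other by assumption.
  + change one with 1.
    pose proof (hab (u p) (u l)). pose proof (hab (u p) (u m)).
    pose proof (hab (u q) (u l)). pose proof (hab (u q) (u m)).
    set (ap := Derive (fun s => H s (u p)) (u c)) in *.
    set (aq := Derive (fun s => H s (u q)) (u c)) in *.
    set (bl := Derive (fun s => H (u l) s) (u c)) in *.
    set (bm := Derive (fun s => H (u m) s) (u c)) in *.
    assert (hl' : (1 - theta) * ap + theta * aq - bl <= K) by nra.
    assert (hm' : (1 - theta) * ap + theta * aq - bm <= K) by nra.
    assert (hS : (1 - theta) * ap + theta * aq - ((1 - mu) * bl + mu * bm) <= K)
      by nra.
    apply (Rmult_le_compat_l r _ _ hr) in hS. lra.
- (* Away from [c] only the neighbours vary. *)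
  destruct (is_derive_set_value (fun x => x <= 0) (H (u c)) u i p)
    as (dp & hdp & sp); [auto.. | lra |].
  destruct (is_derive_set_value (fun x => x <= 0) (H (u c)) u i q)
    as (dq & hdq & sq); [auto.. | lra |].
  destruct (is_derive_set_value (fun x => 0 <= x) (fun x => H x (u c)) u i l)
    as (dl & hdl & sl); [auto.. | lra |].
  destruct (is_derive_set_value (fun x => 0 <= x) (fun x => H x (u c)) u i m)
    as (dm & hdm & sm); [auto.. | lra |].
  eexists. split.
  + eapply is_derive_ext; cycle 1.
    * refine (is_derive_weighted_balance (fun _ => u c) _ _ _ _ r mu theta
        _ _ _ _ _ _ _ hdp hdq hdl hdm).
      apply (@is_derive_const R_AbsRing R_NormedModule).
    * intros s. unfold flux_balance.
      now rewrite (set_value_other u i c) by congruence.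
  + change zero with 0.
    assert (ho : (1 - theta) * dp + theta * dq <= 0) by nra.
    assert (hi : 0 <= (1 - mu) * dl + mu * dm) by nra.
    nra.
Qed.

(** * The stabilized scheme *)

Lemma dod_eta_eq (alpha nu : R) :
  0 < alpha -> alpha < nu -> dod_eta alpha nu = 1 - alpha / nu.
Proof.
intros ha hn. unfold dod_eta. apply Rmax_left.
enough (alpha / nu <= 1) by lra.
apply Rle_div_l; lra.
Qed.

Theorem theorem6
  (xL xR : R) (N k : nat) (alpha nu lambda_max h dt : R)
  (f : R -> R) (H : R -> R -> R)
  (hdomain : xL < xR)
  (hk : (1 < k < N)%nat)
  (halpha : 0 < alpha <= 1 / 2)
  (hh : h = (xR - xL) / INR N)
  (hlambda_pos : 0 < lambda_max)
  (hlambda : is_max_wave_speed f lambda_max)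
  (hdt : dt = nu * h / lambda_max)
  (hnu : 0 < alpha < nu /\ nu < 1 - alpha)
  (hconsistent : forall u, H u u = f u)
  (hlipschitz : exists L, forall u u' v v',
      Rabs (H u v - H u' v') <= L * (Rabs (u - u') + Rabs (v - v')))
  (hincr : forall u u' v, u <= u' -> H u v <= H u' v)
  (hdecr : forall u v v', v <= v' -> H u v' <= H u v)
  (hHa : forall u v : R, ex_derive (fun s => H s v) u)
  (hHb : forall w u : R, ex_derive (fun s => H w s) u)
  (hbound : forall u v w,
      Rabs (Derive (fun s => H s v) u) + Rabs (Derive (fun s => H w s) u)
      <= nu * h / dt) :
  monotone_scheme N k (dod_update H k alpha h dt (dod_eta alpha nu)).
Proof.
assert (hpos : 0 < h).
{ rewrite hh. apply Rdiv_lt_0_compat; [lra|]. apply lt_0_INR. lia. }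
assert (tpos : 0 < dt).
{ rewrite hdt. apply Rdiv_lt_0_compat; [|lra]. apply Rmult_lt_0_compat; lra. }
clear hdt hh.
assert (heta := dod_eta_eq alpha nu ltac:(lra) ltac:(lra)).
assert (heta01 : 0 <= dod_eta alpha nu <= 1).
{ rewrite heta.
  assert (0 < alpha / nu) by (apply Rdiv_lt_0_compat; lra).
  assert (alpha / nu <= 1) by (apply Rle_div_l; lra). lra. }
set (eta := dod_eta alpha nu) in *.
assert (hbalance : forall r mu theta l m c p q i u,
  (forall v, dod_update H k alpha h dt eta v c
             = flux_balance H r mu theta l m c p q v) ->
  0 <= r -> r * (nu * h / dt) <= 1 -> 0 <= mu <= 1 -> 0 <= theta <= 1 ->
  l <> c -> m <> c -> p <> c -> q <> c ->
  exists d, is_derive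
    (fun s => dod_update H k alpha h dt eta (set_value u i s) c) (u i) d /\ 0 <= d).
{ intros r mu theta l m c p q i u e hr hrK hmu htheta hl hm hp hq.
  destruct (flux_balance_monotone H (nu * h / dt) r mu theta l m c p q i u)
    as (d & hd & hd0); auto.
  exists d. split; [|exact hd0].
  eapply is_derive_ext; [|exact hd]. intros s. symmetry. apply e. }
assert (r0 : 0 <= dt / h) by (apply Rlt_le, Rdiv_lt_0_compat; lra).
assert (r1 : dt / h * (nu * h / dt) <= 1).
{ replace (dt / h * (nu * h / dt)) with nu by (field; lra). lra. }
intros c i u hc _.
destruct c as [j| |].
- simpl in hc. destruct hc as [hj hjk].
  destruct (Nat.eqb_spec j (k - 1)) as [->|hj1].
  { apply (hbalance (dt / h) 0 eta (Cell (k - 1 - 1)) (Cell (k - 1 - 1))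
      (Cell (k - 1)) Cut1 Cut2); try lra; try discriminate;
      try (intros [=]; lia).
    intros v. unfold flux_balance. simpl. rewrite Nat.eqb_refl. ring. }
  destruct (Nat.eqb_spec j (k + 1)) as [->|hj2].
  { apply (hbalance (dt / h) 0 0 Cut2 Cut2 (Cell (k + 1))
      (Cell (k + 1 + 1)) (Cell (k + 1 + 1))); try lra; try discriminate;
      try (intros [=]; lia).
    intros v. unfold flux_balance. simpl. rewrite Nat.eqb_refl.
    destruct (Nat.eqb_spec (k + 1) (k - 1)); [lia|]. ring. }
  apply (hbalance (dt / h) 0 0 (Cell (j - 1)) (Cell (j - 1)) (Cell j)
      (Cell (j + 1)) (Cell (j + 1))); try lra; try (intros [=]; lia).
  intros v. unfold flux_balance. simpl.
  destruct (Nat.eqb_spec j (k - 1)); [lia|].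
  destruct (Nat.eqb_spec j (k + 1)); [lia|]. ring.
- (* The factor [1 - eta] is part of the step ratio: it scales the whole flux
     difference of the small cell and restores its CFL condition. *)
  apply (hbalance (dt / (alpha * h) * (1 - eta)) 0 0
      (Cell (k - 1)) (Cell (k - 1)) Cut1 Cut2 Cut2); try lra; try discriminate.
  + intros v. unfold flux_balance. simpl. ring.
  + apply Rmult_le_pos; [|lra].
    apply Rlt_le, Rdiv_lt_0_compat; [lra|]. apply Rmult_lt_0_compat; lra.
  + rewrite heta. right. field. lra.
- apply (hbalance (dt / ((1 - alpha) * h)) eta 0
      Cut1 (Cell (k - 1)) Cut2 (Cell (k + 1)) (Cell (k + 1)));
    try lra; try discriminate.
  + intros v. unfold flux_balance. simpl. ring.
  + apply Rlt_le, Rdiv_lt_0_compat; [lra|]. apply Rmult_lt_0_compat; lra.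
  + replace (dt / ((1 - alpha) * h) * (nu * h / dt)) with (nu / (1 - alpha))
      by (field; lra).
    apply Rle_div_l; lra.
Qed.
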